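(* Let $n\ge 3$ be an integer, $r>0$ and $\varepsilon\in[0,1)$. Then the map $\mathcal T_n:\mathbb S^2(r)\to\mathbb K_n(r,\varepsilon)$ (defined in the context) is continuous.
   Context: $\mathbb S^2(r)$ is the sphere of radius $r$ centered at the origin $O$ of $\mathbb R^3$. Notation: $\alpha_i=\frac{2\pi i}{n}$, $R_n=\frac{\pi r}{n\sin(\pi/n)}$. The polyhedron $\mathbb K_n(r,\varepsilon)$ (regarded as a surface) is formed by the lateral surface of a regular prism and the lateral surfaces of two congruent pyramids. The prism has height $2\varepsilon r$, is centered at $O$ and symmetric with respect to the plane $z=0$, and its bases are regular $n$-gons of edge $\frac{2\pi r}{n}$ (circumscribed radius $R_n$) in the planes $z=\pm\varepsilon r$, with vertices $(R_n\cos\alpha_i,R_n\sin\alpha_i,\pm\varepsilon r)$, $i=0,\dots,n-1$. The bases of the two pyramids, one above and one below, coincide with the two bases of the prism, and each pyramid has lateral area $2\pi(1-\varepsilon)r^2$. Hence the slant height of each pyramid is $2(1-\varepsilon)r$ and its altitude is $$b_n=r\left(4(1-\varepsilon)^2-\frac{\pi^2}{n^2}\cot^2\frac{\pi}{n}\right)^{1/2}.$$ When $\varepsilon=0$ the prism degenerates to a polygon. The map $\mathcal T_n$: for $(x,y,z)\in\mathbb S^2(r)$ let $\theta\in[0,2\pi)$ be the longitude, $(x,y)=\sqrt{r^2-z^2}\,(\cos\theta,\sin\theta)$ ($\theta$ is arbitrary at the poles), let $i\in\{0,\dots,n-1\}$ be such that $\alpha_i\le\theta<\alpha_{i+1}$,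 and put $$w(\theta)=\left(\frac{\pi\cos\alpha_i}{n\sin\frac{\pi}{n}}-\sin\left(\alpha_i+\tfrac{\pi}{n}\right)(\theta-\alpha_i),\ \frac{\pi\sin\alpha_i}{n\sin\frac{\pi}{n}}+\cos\left(\alpha_i+\tfrac{\pi}{n}\right)(\theta-\alpha_i)\right)\in\mathbb R^2.$$ Then $(X,Y,Z)=\mathcal T_n(x,y,z)$ is defined by: - if $z>\varepsilon r$: $(X,Y)=\sqrt{\frac{r(r-z)}{1-\varepsilon}}\;w(\theta)$, $Z=\varepsilon r+b_n\left(1-\sqrt{\frac{1-z/r}{1-\varepsilon}}\right)$; - if $|z|\le\varepsilon r$: $(X,Y)=r\,w(\theta)$, $Z=z$; - if $z<-\varepsilon r$: $(X,Y)=\sqrt{\frac{r(r+z)}{1-\varepsilon}}\;w(\theta)$, $Z=-\varepsilon r-b_n\left(1-\sqrt{\frac{1+z/r}{1-\varepsilon}}\right)$. *)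

(* Defs.v *)
From mathcomp Require Import all_boot all_order all_algebra.
From mathcomp Require Import all_classical all_reals all_analysis.

Set Implicit Arguments.
Unset Strict Implicit.
Unset Printing Implicit Defensive.

Import Order.TTheory GRing.Theory Num.Theory.
Import numFieldNormedType.Exports.

Local Open Scope classical_set_scope.
Local Open Scope ring_scope.

(* R^3 is [R * R * R] with the product topology; points are written
   (x, y, z). *)

Definition sphere3 (R : realType) (r : R) : set (R * R * R) :=
  [set p | let '(x, y, z) := p in x ^+ 2 + y ^+ 2 + z ^+ 2 = r ^+ 2].

Definition convex_hull (R : realType) (A : set (R * R * R)) :
    set (R * R * R) :=
  \bigcap_(C in [set C : set (R * R * R) | convex_set C /\ A `<=` C]) C.

Section Polyhedron.
Context {R : realType}.
Variables (n : nat) (r eps : R).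

Definition alpha (i : nat) : R := 2 * pi * i%:R / n%:R.

Definition circumradius : R := pi * r / (n%:R * sin (pi / n%:R)).

Definition vertex (h : R) (i : nat) : R * R * R :=
  (circumradius * cos (alpha i), circumradius * sin (alpha i), h).

(* A pyramid of slant height 2(1 - eps)r exists only if the radicand is
   nonnegative; [Num.sqrt] is 0 on negative arguments, in which case both
   pyramids are flattened onto their bases. *)
Definition altitude : R :=
  r * Num.sqrt (4 * (1 - eps) ^+ 2 -
    pi ^+ 2 / n%:R ^+ 2 * (cos (pi / n%:R) / sin (pi / n%:R)) ^+ 2).

(* Since [vertex h n = vertex h 0], the side with index [n.-1] closes the
   polygon. *)
Definition prism_lateral : set (R * R * R) :=
  \bigcup_(i in [set i : nat | (i < n)%N])
    convex_hull [set vertex (- (eps * r)) i; vertex (- (eps * r)) i.+1;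
                     vertex (eps * r) i; vertex (eps * r) i.+1].

(* Base in the plane z = h, apex (0, 0, a). *)
Definition pyramid_lateral (h a : R) : set (R * R * R) :=
  \bigcup_(i in [set i : nat | (i < n)%N])
    convex_hull [set vertex h i; vertex h i.+1; (0, 0, a)].

Definition polyhedronK : set (R * R * R) :=
  prism_lateral
  `|` pyramid_lateral (eps * r) (eps * r + altitude)
  `|` pyramid_lateral (- (eps * r)) (- (eps * r) - altitude).

(* At the poles every t in [0, 2 pi[ qualifies and [xget] returns an
   unspecified one. *)
Definition longitude (p : R * R * R) : R :=
  let '(x, y, z) := p in
  xget 0 [set t : R | 0 <= t < 2 * pi /\
    (x = Num.sqrt (r ^+ 2 - z ^+ 2) * cos t /\
     y = Num.sqrt (r ^+ 2 - z ^+ 2) * sin t)].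

Definition sector (t : R) : nat :=
  xget 0%N [set i : nat | (i < n)%N /\ alpha i <= t < alpha i.+1].

Definition w (t : R) : R * R :=
  let a := alpha (sector t) in
  (pi * cos a / (n%:R * sin (pi / n%:R)) - sin (a + pi / n%:R) * (t - a),
   pi * sin a / (n%:R * sin (pi / n%:R)) + cos (a + pi / n%:R) * (t - a)).

Definition mapT (p : R * R * R) : R * R * R :=
  let z := p.2 in
  let u := w (longitude p) in
  if eps * r < z then
    (Num.sqrt (r * (r - z) / (1 - eps)) * u.1,
     Num.sqrt (r * (r - z) / (1 - eps)) * u.2,
     eps * r + altitude * (1 - Num.sqrt ((1 - z / r) / (1 - eps))))
  else if z < - (eps * r) then
    (Num.sqrt (r * (r + z) / (1 - eps)) * u.1,
     Num.sqrt (r * (r + z) / (1 - eps)) * u.2,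
     - (eps * r) - altitude * (1 - Num.sqrt ((1 + z / r) / (1 - eps))))
  else (r * u.1, r * u.2, z).

End Polyhedron.

(* Main.v *)
(* Polar coordinates (t, z) on [0, 2 pi] x [- r, r] map a compact rectangle onto
   the sphere, and a continuous surjection from a compact space onto a Hausdorff
   one is a quotient map.  So T_n is continuous as soon as it is continuous in
   the coordinates (t, z), where neither the jump of the longitude nor its
   indeterminacy at the poles is visible: there T_n is given by closed formulas
   made of clamps and square roots, continuous on all of R^2.  For the
   inclusion of the image in K_n, r w(t) is a point of an edge of the polygon,
   and T_n(p) divides the segment from that point to an apex, or a vertical
   segment of the prism. *)
Require Import Defs.
From mathcomp Require Import all_boot all_order all_algebra.
From mathcomp Require Import all_classical all_reals all_analysis.
From mathcomp Require Import ring lra.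

Set Implicit Arguments.
Unset Strict Implicit.
Unset Printing Implicit Defensive.

Import Order.TTheory GRing.Theory Num.Theory.
Import numFieldNormedType.Exports.

Local Open Scope classical_set_scope.
Local Open Scope ring_scope.

(** * Continuity through a compact parametrisation *)

Lemma continuous_pair (X Y Z : topologicalType) (f : X -> Y) (g : X -> Z) :
  continuous f -> continuous g -> continuous (fun x => (f x, g x)).
Proof. by move=> cf cg x; apply: cvg_pair (cf x) (cg x). Qed.

Lemma within_continuous_compact_image (X Y Z : topologicalType)
  (K : set X) (phi : X -> Y) (f : Y -> Z) (g : X -> Z) :
  hausdorff_space Y -> compact K -> continuous phi -> continuous g ->
  (forall x, K x -> f (phi x) = g x) -> {within phi @` K, continuous f}.
Proof.
move=> hY cK cphi cg fg; apply/continuous_closedP => C cC.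
apply/closed_subspaceP; exists (phi @` (K `&` g @^-1` C)).
  apply: compact_closed => //; apply: continuous_compact.
    exact: continuous_subspaceT.
  apply: compact_closedI => //.
  by move/continuous_closedP : cg; exact.
apply/seteqP; split => y.
- by move=> [[x [Kx Cgx] <-] Ky]; split => //; rewrite /preimage/= /from_subspace fg.
- move=> [Cfy [x Kx xy]]; split; last by exists x.
  by exists x => //; split => //=; rewrite /preimage /= -fg // xy.
Qed.

(** * Convex hulls in coordinates *)

Section ConvexHull.
Context {R : realType}.
Implicit Types (A : set (R * R * R)) (p q : R * R * R).

Lemma sub_convex_hull A : A `<=` convex_hull A.
Proof. by move=> p Ap C [_]; exact. Qed.

Lemma convex_hull_comb A p q (c : R) : 0 <= c <= 1 ->
  convex_hull A p -> convex_hull A q ->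
  convex_hull A (c * p.1.1 + (1 - c) * q.1.1,
                 c * p.1.2 + (1 - c) * q.1.2, c * p.2 + (1 - c) * q.2).
Proof.
move=> /andP[c0 c1] Ap Aq C CA.
have /(_ p q (Itv01 c0 c1)) := CA.1.
rewrite !inE => /(_ (Ap _ CA) (Aq _ CA)).
exact.
Qed.

End ConvexHull.

(** * Angles and polar coordinates *)

Section Angles.
Context {R : realType}.
Implicit Types a b x y rho : R.

(** The duplication formula turns [cos x = 1] into [sin (x / 2) = 0], while the sine is positive
    strictly between 0 and [pi]. *)
Lemma cos_eq1 x : 0 <= x <= 2 * pi -> cos x = 1 -> x = 0 \/ x = 2 * pi.
Proof.
move=> /andP[x0 x2pi] cx.
have sx : sin (x / 2) = 0.
  have xE : x = x / 2 *+ 2 by rewrite -mulr_natr; field.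
  rewrite xE cos_mulr2n in cx.
  have := cos2Dsin2 (x / 2) => cs.
  apply/eqP; rewrite -sqrf_eq0; apply/eqP. lra.
have [->|xn0] := eqVneq x 0; first by left.
have [->|xn2] := eqVneq x (2 * pi); first by right.
have : 0 < sin (x / 2).
  apply: sin_gt0_pi.
  have : 0 < x by rewrite lt_neqAle eq_sym xn0.
  have : x < 2 * pi by rewrite lt_neqAle xn2.
  lra.
by rewrite sx ltxx.
Qed.

(** The subtraction formula gives [cos (b - a) = 1]. The intervals differ because [a] will be a
    longitude and [b] a coordinate in the closed rectangle. *)
Lemma cos_sin_inj a b : 0 <= a < 2 * pi -> 0 <= b <= 2 * pi ->
  cos a = cos b -> sin a = sin b -> b = a \/ (b = 2 * pi /\ a = 0).
Proof.
move=> /andP[a0 a2] /andP[b0 b2] cab sab.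
have cd : cos `|b - a| = 1.
  by rewrite cos_norm cosB cab sab -!expr2 cos2Dsin2.
have : 0 <= `|b - a| <= 2 * pi.
  by rewrite normr_ge0 /= ler_norml; apply/andP; split; lra.
move=> /cos_eq1/(_ cd)[/eqP|].
  by rewrite normr_eq0 subr_eq0 => /eqP ->; left.
case: (lerP 0 (b - a)) => ba; last by rewrite ltr0_norm// => ?; lra.
rewrite ger0_norm// => ?.
by right; split; lra.
Qed.

Lemma polar_coordinates x y rho : 0 <= rho -> x ^+ 2 + y ^+ 2 = rho ^+ 2 ->
  exists2 a, 0 <= a < 2 * pi & x = rho * cos a /\ y = rho * sin a.
Proof.
move=> rho0 xy.
have pi0 : 0 < pi :> R := pi_gt0 R.
move: rho0; rewrite le_eqVlt => /predU1P[rho0|rho0].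
  move/eqP: xy; rewrite -rho0 expr0n/= paddr_eq0 ?sqr_ge0// !sqrf_eq0.
  by move=> /andP[/eqP -> /eqP ->]; exists 0; rewrite ?mul0r//; lra.
have c1 : (x / rho) ^+ 2 + (y / rho) ^+ 2 = 1.
  by rewrite !expr_div_n -mulrDl xy divff// expf_neq0// gt_eqF.
have cI : -1 <= x / rho <= 1.
  rewrite -ler_norml -(@ler_pXn2r _ 2)// ?nnegrE// expr1n real_normK ?num_real//.
  by rewrite -c1 lerDl sqr_ge0.
have xE : x = rho * (x / rho) by rewrite mulrCA divff ?mulr1// gt_eqF.
have yE : y = rho * (y / rho) by rewrite mulrCA divff ?mulr1// gt_eqF.
have sE : sin (acos (x / rho)) = `|y / rho|.
  by rewrite sin_acos// -c1 addrAC subrr add0r sqrtr_sqr.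
have := acos_ge0 cI; have := acos_lepi cI.
case: (lerP 0 y) => y0 ap a0.
  exists (acos (x / rho)); first lra.
  rewrite acosK ?in_itv// sE ger0_norm ?divr_ge0 ?(ltW rho0)//.
have yr : y / rho < 0 by rewrite pmulr_llt0 ?invr_gt0.
exists (2 * pi - acos (x / rho)).
  (* The strict bound by [2 * pi] fails only if the arccosine is 0, which would force [y = 0]. *)
  suff : acos (x / rho) != 0 by rewrite lt_neqAle in a0 *; lra.
  apply/eqP => a00; move: sE; rewrite a00 sin0 ltr0_norm// => /eqP.
  by rewrite eq_sym oppr_eq0 lt_eqF.
rewrite cosB sinB mulr_natl cos2pi sin2pi acosK ?in_itv// sE ltr0_norm//.
by split; lra.
Qed.

End Angles.

(** * Piecewise affine functions as sums of clamps *)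

Section Polyline.
Context {R : realType}.
Variables (V D : nat -> R) (L : R) (n : nat).
Hypotheses (L0 : 0 < L) (VD : forall i, V i.+1 - V i = D i * L).

(* The clamp vanishes before the i-th step and equals L after it. *)
Definition polyline (t : R) : R :=
  V 0%N + \sum_(i < n) D i * Num.min (Num.max (t - L * i%:R) 0) L.

Lemma continuous_polyline : continuous polyline.
Proof.
move=> t; apply: cvgD; first exact: cvg_cst.
apply: cvg_big => [|i _]; first exact: add_continuous.
apply: cvgM; first exact: cvg_cst.
apply: (@continuous_min R R (fun s => Num.max (s - L * i%:R) 0) (cst L)).
  apply: (@continuous_max R R (fun s => s - L * i%:R) (cst 0)).
    by apply: cvgB; [exact: cvg_id|exact: cvg_cst].
  exact: cvg_cst.
exact: cvg_cst.
Qed.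

Lemma sum_polyline_steps (i : nat) : \sum_(0 <= j < i) D j * L = V i - V 0%N.
Proof. by rewrite -(telescope_sumr V)//; apply: eq_bigr => j _; rewrite VD. Qed.

(** Earlier clamps are saturated at [L], so their steps telescope to [V i - V 0]; later clamps are
    still 0. Both endpoints are allowed, which makes the value at the end of the last step
    accessible. *)
Lemma polylineE (i : nat) (t : R) : (i < n)%N ->
  L * i%:R <= t <= L * i.+1%:R -> polyline t = V i + D i * (t - L * i%:R).
Proof.
move=> ilt /andP[it ti]; rewrite /polyline.
rewrite -(big_mkord xpredT (fun i : nat => D i * Num.min (Num.max (t - L * i%:R) 0) L)).
rewrite (big_cat_nat (n := i)) ?(ltnW ilt)//= (big_ltn ilt)/=.
rewrite (eq_big_nat _ _ (F2 := fun j => D j * L)); last first.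
  move=> j /andP[_ ji].
  have : L * j.+1%:R <= L * i%:R by rewrite ler_pM2l// ler_nat.
  rewrite -natr1 mulrDr mulr1 => jL.
  by rewrite max_l ?min_r//; lra.
rewrite sum_polyline_steps [X in D i * _ + X]big_nat_cond big1; last first.
  move=> j; rewrite andbT => /andP[ij _].
  have : L * i.+1%:R <= L * j%:R by rewrite ler_pM2l// ler_nat.
  by move=> ijL; rewrite max_r ?min_l ?mulr0//; lra.
move: ti; rewrite -natr1 mulrDr mulr1 => ti.
rewrite max_l ?min_l//; [ring|lra|lra].
Qed.

Lemma polyline_last : (0 < n)%N -> polyline (L * n%:R) = V n.
Proof.
move=> n0; have nE : n%:R = n.-1%:R + 1 :> R by rewrite natr1 prednK.
rewrite (polylineE (i := n.-1)) ?prednK//.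
  have := VD n.-1; rewrite prednK// => VDn.
  by rewrite nE (mulrDr L) mulr1 addrAC subrr add0r -VDn addrC subrK.
by rewrite lexx andbT ler_pM2l// ler_nat leq_pred.
Qed.

End Polyline.

(** * The regular polygon and the curve w *)

Section Polygon.
Context {R : realType}.
Variable n : nat.
Hypothesis n3 : (3 <= n)%N.

(** [L] is both the angular step of [alpha] and the edge of the polygon for [r = 1]; [K] is the
    circumradius of that polygon. *)
Let L : R := 2 * pi / n%:R.
Let K : R := pi / (n%:R * sin (pi / n%:R)).

Let n_neq0 : n%:R != 0 :> R.
Proof. by rewrite pnatr_eq0; case: n n3. Qed.

Let n_pos : (0 < n)%N.
Proof. exact: leq_trans n3. Qed.

Let n_gt0 : 0 < n%:R :> R.
Proof. by rewrite ltr0n; case: n n3. Qed.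

Let L_gt0 : 0 < L.
Proof. by rewrite /L divr_gt0// mulr_gt0// pi_gt0. Qed.

Lemma sin_pi_div_gt0 : 0 < sin (pi / n%:R) :> R.
Proof.
apply: sin_gt0_pi; rewrite divr_gt0 ?pi_gt0//= ltr_pdivrMr//.
by rewrite ltr_pMr ?pi_gt0// ltr1n; exact: leq_trans n3.
Qed.

Lemma alphaE i : alpha n i = L * i%:R :> R.
Proof. by rewrite /alpha /L mulrAC. Qed.

Lemma alphaS i : alpha n i.+1 = alpha n i + pi / n%:R + pi / n%:R :> R.
Proof. by rewrite !alphaE /L -natr1; field. Qed.

(** With m the mid-angle of the edge and h = [pi / n], cos(m + h) - cos(m - h) = -2 sin m sin h, and
    [K] cancels the factor sin h. *)
Lemma edge_cos i : K * cos (alpha n i.+1) - K * cos (alpha n i) =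
  - sin (alpha n i + pi / n%:R) * L.
Proof.
rewrite alphaS.
rewrite -{2}(addrK (pi / n%:R) (alpha n i)) [in LHS]cosD cosB /K /L.
by field; rewrite n_neq0 gt_eqF ?sin_pi_div_gt0.
Qed.

Lemma edge_sin i : K * sin (alpha n i.+1) - K * sin (alpha n i) =
  cos (alpha n i + pi / n%:R) * L.
Proof.
rewrite alphaS.
rewrite -{2}(addrK (pi / n%:R) (alpha n i)) [in LHS]sinD sinB /K /L.
by field; rewrite n_neq0 gt_eqF ?sin_pi_div_gt0.
Qed.

Lemma sectorP (t : R) : 0 <= t < 2 * pi ->
  (sector n t < n)%N /\ alpha n (sector n t) <= t < alpha n (sector n t).+1.
Proof.
move=> /andP[t0 t2].
suff : exists i, (i < n)%N /\ alpha n i <= t < alpha n i.+1.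
  by move/xgetPex => /(_ 0%N).
(* The bound is generalised for the induction; it is used at [m = n], where [alpha n n = 2 * pi]. *)
suff : forall m, t < alpha n m ->
    exists i, (i < m)%N /\ alpha n i <= t < alpha n i.+1.
  by apply; rewrite /alpha mulfK.
elim=> [|m IH tm]; first by rewrite alphaE mulr0 => /(le_lt_trans t0); rewrite ltxx.
case: (ltP t (alpha n m)) => [/IH[i [im hi]]|mt]; last by exists m; rewrite mt tm.
by exists i; split => //; exact: ltnW.
Qed.

(** First coordinate of [w] without the choice of a sector: a function continuous on the whole line,
    whose value at [2 * pi] is meaningful and returns to that at 0 because the polygon closes. *)
Definition wx : R -> R :=
  polyline (fun i => K * cos (alpha n i)) (fun i => - sin (alpha n i + pi / n%:R)) L n.

Definition wy : R -> R :=
  polyline (fun i => K * sin (alpha n i)) (fun i => cos (alpha n i + pi / n%:R)) L n.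

Lemma continuous_wx : continuous wx.
Proof. exact: continuous_polyline. Qed.

Lemma continuous_wy : continuous wy.
Proof. exact: continuous_polyline. Qed.

Lemma w_polyline (t : R) : 0 <= t < 2 * pi -> w n t = (wx t, wy t).
Proof.
move=> /sectorP[sn]; rewrite !alphaE => /andP[/= st /ltW ts].
rewrite /wx /wy (polylineE L_gt0 edge_cos sn) ?st//.
rewrite (polylineE L_gt0 edge_sin sn) ?st//.
by rewrite /w alphaE /K mulNr [pi * cos _ / _]mulrAC [pi * sin _ / _]mulrAC.
Qed.

Lemma wx_periodic : wx (2 * pi) = wx 0.
Proof.
have -> : 2 * pi = L * n%:R by rewrite /L divfK.
rewrite /wx (polyline_last L_gt0 edge_cos)//.
rewrite (polylineE L_gt0 edge_cos n_pos)//.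
  by rewrite !alphaE mulr0 subrr mulr0 addr0 /L divfK// mulr_natl cos2pi cos0.
by rewrite mulr0 lexx mulr1 ltW.
Qed.

Lemma wy_periodic : wy (2 * pi) = wy 0.
Proof.
have -> : 2 * pi = L * n%:R by rewrite /L divfK.
rewrite /wy (polyline_last L_gt0 edge_sin)//.
rewrite (polylineE L_gt0 edge_sin n_pos)//.
  by rewrite !alphaE mulr0 subrr mulr0 addr0 /L divfK// mulr_natl sin2pi sin0.
by rewrite mulr0 lexx mulr1 ltW.
Qed.

Lemma w_between_vertices (r h t : R) : 0 <= t < 2 * pi ->
  exists2 c, 0 <= c <= 1 &
    (r * (w n t).1, r * (w n t).2, h) =
    c *: vertex n r h (sector n t) + (1 - c) *: vertex n r h (sector n t).+1.
Proof.
move=> /sectorP[_]; set i := sector n t => /andP[it ti].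
move: (it) (ti); rewrite !alphaE -natr1 mulrDr mulr1 => it' ti'.
(* For [r = 1], [t - alpha n i] is the length already travelled along an edge of length [L]. *)
exists (1 - (t - alpha n i) / L).
  rewrite subr_ge0 lerBlDr lerDl ler_pdivrMr// mul1r divr_ge0 ?(ltW L_gt0)//=.
    by rewrite alphaE; lra.
  by rewrite subr_ge0.
have ec := edge_cos i; have es := edge_sin i.
(* Writing the far vertex as the near one plus an edge vector exposes the differences computed by
   [edge_cos] and [edge_sin]. *)
have -> : vertex n r h i.+1 = vertex n r h i +
  (r * (K * cos (alpha n i.+1) - K * cos (alpha n i)),
   r * (K * sin (alpha n i.+1) - K * sin (alpha n i)), 0).
  by rewrite /vertex /circumradius /K; congr (_, _, _) => /=; ring.
rewrite ec es /w /vertex /circumradius -/i.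
have Ln0 : L != 0 by rewrite gt_eqF.
have sn0 : sin (pi / n%:R) != 0 :> R by rewrite gt_eqF ?sin_pi_div_gt0.
congr (_, _, _) => /=; rewrite /GRing.scale/=; field; rewrite ?Ln0 ?sn0 ?n_neq0//.
Qed.

End Polygon.

(** * The sphere and the map in polar coordinates *)

Section Parametrisation.
Context {R : realType}.
Variables (n : nat) (r eps : R).
Hypotheses (n3 : (3 <= n)%N) (r0 : 0 < r) (eps0 : 0 <= eps) (eps1 : eps < 1).

Definition sphere_param (q : R * R) : R * R * R :=
  (Num.sqrt (r ^+ 2 - q.2 ^+ 2) * cos q.1,
   Num.sqrt (r ^+ 2 - q.2 ^+ 2) * sin q.1, q.2).

(** The value [2 * pi] is included for compactness, so the meridian of longitude 0 is covered
    twice. *)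
Definition param_domain : set (R * R) := `[0, 2 * pi] `*` `[- r, r].

Lemma continuous_sphere_param : continuous sphere_param.
Proof.
have cs : continuous (fun q : R * R => Num.sqrt (r ^+ 2 - q.2 ^+ 2)).
  move=> q; apply: continuous_cvg; first exact: sqrt_continuous.
  apply: cvgB; first exact: cvg_cst.
  exact: (cvgM cvg_snd cvg_snd).
apply: continuous_pair; last by move=> q; exact: cvg_snd.
apply: continuous_pair => q; apply: cvgM; try exact: cs.
  by apply: continuous_cvg; [exact: continuous_cos|exact: cvg_fst].
by apply: continuous_cvg; [exact: continuous_sin|exact: cvg_fst].
Qed.

Lemma compact_param_domain : compact param_domain.
Proof. by apply: compact_setX; exact: segment_compact. Qed.

Lemma sphere3_le x y z : sphere3 r (x, y, z) -> - r <= z <= r.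
Proof.
move=> xyz; rewrite -ler_norml -(@ler_pXn2r _ 2)// ?nnegrE ?(ltW r0)//.
by rewrite real_normK ?num_real// -xyz lerDr addr_ge0 ?sqr_ge0.
Qed.

Lemma sphere3_longitude x y z : sphere3 r (x, y, z) ->
  let t := longitude r (x, y, z) in
  0 <= t < 2 * pi /\ (x = Num.sqrt (r ^+ 2 - z ^+ 2) * cos t /\
                      y = Num.sqrt (r ^+ 2 - z ^+ 2) * sin t).
Proof.
move=> xyz.
have xyE : x ^+ 2 + y ^+ 2 = r ^+ 2 - z ^+ 2 by rewrite -xyz addrK.
have [a ha xy] : exists2 a, 0 <= a < 2 * pi &
    x = Num.sqrt (r ^+ 2 - z ^+ 2) * cos a /\
    y = Num.sqrt (r ^+ 2 - z ^+ 2) * sin a.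
  apply: polar_coordinates; first exact: sqrtr_ge0.
  by rewrite sqr_sqrtr// -xyE addr_ge0 ?sqr_ge0.
by apply: (@xgetPex R 0 [set t : R | 0 <= t < 2 * pi /\ _]); exists a.
Qed.

Lemma sphere_param_image : sphere_param @` param_domain = sphere3 r.
Proof.
apply/seteqP; split => [_ [[t z] [_ /= zr] <-]|[[x y] z] xyz].
  rewrite /sphere3 /sphere_param /= !exprMn -mulrDr cos2Dsin2 mulr1.
  rewrite sqr_sqrtr ?subrK// subr_ge0 -(real_normK (num_real z)).
  rewrite ler_pXn2r ?nnegrE ?(ltW r0)// ler_norml.
  by move: zr; rewrite in_itv.
have [/andP[t0 t1] [xE yE]] := sphere3_longitude xyz.
exists (longitude r (x, y, z), z).
  by split => /=; rewrite in_itv/= ?t0 ?(ltW t1)//; exact: sphere3_le xyz.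
by rewrite /sphere_param [fst _]/= [snd _]/= -xE -yE.
Qed.

(* Homothety factor of the horizontal section at height [z] seen from the upper
   apex; it is 1 below the upper base, and [scale (- z)] serves the lower one. *)
Definition scale (z : R) : R := Num.min 1 (Num.sqrt ((1 - z / r) / (1 - eps))).

(** One formula for the three cases of [mapT]: as [eps * r >= 0], at least one of [scale z] and
    [scale (- z)] is 1, so the product is the active factor and at most one altitude term survives.
    The max and min clamp [z] to the prism. *)
Definition folded (u : R * R) (z : R) : R * R * R :=
  (r * (scale z * scale (- z)) * u.1, r * (scale z * scale (- z)) * u.2,
   Num.max (Num.min z (eps * r)) (- (eps * r))
   + altitude n r eps * (1 - scale z) - altitude n r eps * (1 - scale (- z))).

Lemma continuous_scale : continuous scale.
Proof.
move=> z; apply: (@continuous_min R R (cst 1)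
  (fun z => Num.sqrt ((1 - z / r) / (1 - eps)))); first exact: cvg_cst.
apply: continuous_cvg; first exact: sqrt_continuous.
apply: cvgM; last exact: cvg_cst.
apply: cvgB; first exact: cvg_cst.
by apply: cvgM; [exact: cvg_id|exact: cvg_cst].
Qed.

Lemma scale_eq1 z : z <= eps * r -> scale z = 1.
Proof.
move=> zle; rewrite /scale min_l// -[leLHS]sqrtr1 ler_wsqrtr//.
rewrite ler_pdivlMr ?subr_gt0// mul1r lerD2l lerN2.
by rewrite ler_pdivrMr.
Qed.

Lemma scale_sqrt z : eps * r <= z -> scale z = Num.sqrt ((1 - z / r) / (1 - eps)).
Proof.
move=> lez; rewrite /scale min_r// -[leRHS]sqrtr1 ler_wsqrtr//.
rewrite ler_pdivrMr ?subr_gt0// mul1r lerD2l lerN2.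
by rewrite ler_pdivlMr.
Qed.

Lemma scale_ge0_le1 z : 0 <= scale z <= 1.
Proof. by rewrite /scale le_min ler01 sqrtr_ge0 ge_min lexx. Qed.

Lemma scale_radius : scale r = 0.
Proof.
by rewrite scale_sqrt ?divff ?subrr ?mul0r ?sqrtr0 ?gt_eqF// ler_piMl// ltW.
Qed.

Lemma mapTE p : mapT n r eps p = folded (w n (longitude r p)) p.2.
Proof.
have er0 : 0 <= eps * r by rewrite mulr_ge0// ltW.
(* Extracting [r ^+ 2] from the root shows that the horizontal and vertical formulas share one
   factor. *)
have sqrtE z : Num.sqrt (r * (r - z) / (1 - eps)) =
    r * Num.sqrt ((1 - z / r) / (1 - eps)).
  rewrite -[X in X * Num.sqrt _]ger0_norm ?(ltW r0)// -sqrtr_sqr -sqrtrM ?sqr_ge0//.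
  congr Num.sqrt; field.
  by rewrite !gt_eqF// subr_gt0.
rewrite /mapT /folded; set u := w _ _; case: p @u => -[x y] z u /=.
case: ifPn => [zgt|]; last rewrite -leNgt => zle.
  rewrite (scale_eq1 (z := - z)) ?(scale_sqrt (z := z)) ?(ltW zgt)//; last lra.
  rewrite sqrtE min_r ?max_l ?(ltW zgt)//; last lra.
  by rewrite mulr1 subrr mulr0 subr0.
rewrite (scale_eq1 zle) mul1r subrr mulr0 addr0 min_l//.
case: ifPn => [zlt|]; last rewrite -leNgt => zge.
  have := sqrtE (- z); rewrite mulNr !opprK => ->.
  by rewrite scale_sqrt ?mulNr ?opprK ?max_r ?(ltW zlt)//; lra.
by rewrite scale_eq1 ?mulr1 ?subrr ?mulr0 ?subr0 ?max_l//; lra.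
Qed.

Definition mapT_param (q : R * R) : R * R * R := folded (wx n q.1, wy n q.1) q.2.

Lemma continuous_mapT_param : continuous mapT_param.
Proof.
have cz (q : R * R) : scale q'.2 @[q' --> q] --> scale q.2.
  by apply: continuous_cvg; [exact: continuous_scale|exact: cvg_snd].
have cNz (q : R * R) : scale (- q'.2) @[q' --> q] --> scale (- q.2).
  apply: continuous_cvg; first exact: continuous_scale.
  by apply: cvgN; exact: cvg_snd.
have crs (q : R * R) : r * (scale q'.2 * scale (- q'.2)) @[q' --> q]
    --> r * (scale q.2 * scale (- q.2)).
  by apply: cvgM; [exact: cvg_cst|apply: cvgM; [exact: cz|exact: cNz]].
have calt (c : R) (f : R * R -> R) q : f q' @[q' --> q] --> f q ->
    c * (1 - f q') @[q' --> q] --> c * (1 - f q).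
  by move=> cf; apply: cvgM; [exact: cvg_cst|apply: cvgB; [exact: cvg_cst|]].
apply: continuous_pair; first apply: continuous_pair; move=> q.
- apply: cvgM; first exact: crs.
  by apply: (@continuous_cvg _ _ _ _ _ _ (wx n)); [exact: continuous_wx|exact: cvg_fst].
- apply: cvgM; first exact: crs.
  by apply: (@continuous_cvg _ _ _ _ _ _ (wy n)); [exact: continuous_wy|exact: cvg_fst].
- apply: cvgB; last exact: (calt _ (fun q => scale (- q.2))).
  apply: cvgD; last exact: (calt _ (fun q => scale q.2)).
  apply: (@continuous_max R (R * R)%type (fun q => Num.min q.2 (eps * r)) (cst _)).
    apply: (@continuous_min R (R * R)%type snd (cst _)); first exact: cvg_snd.
    exact: cvg_cst.
  exact: cvg_cst.
Qed.

(** The parameter [t] and the longitude of the same point can differ only at a pole, where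
    everything collapses to the apex, or as [2 * pi] against 0, where [wx] and [wy] agree. *)
Lemma mapT_sphere_param q : param_domain q ->
  mapT n r eps (sphere_param q) = mapT_param q.
Proof.
move=> Dq; have : sphere3 r (sphere_param q) by rewrite -sphere_param_image; exists q.
case: q Dq => t z [/= ht hz] Sq; rewrite mapTE; set t' := longitude r _.
have [ht' [ct st]] : 0 <= t' < 2 * pi /\
    (Num.sqrt (r ^+ 2 - z ^+ 2) * cos t = Num.sqrt (r ^+ 2 - z ^+ 2) * cos t' /\
     Num.sqrt (r ^+ 2 - z ^+ 2) * sin t = Num.sqrt (r ^+ 2 - z ^+ 2) * sin t').
  exact: sphere3_longitude Sq.
rewrite in_itv/= in ht; rewrite in_itv/= -ler_norml in hz.
change (folded (w n t') z = folded (wx n t, wy n t) z).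
have [rho0|rho_neq0] := eqVneq (Num.sqrt (r ^+ 2 - z ^+ 2)) 0.
  (* At the poles the scale vanishes, whatever the longitude. *)
  suff s0 : scale z * scale (- z) = 0 by rewrite /folded s0 mulr0 !mul0r.
  move/eqP: rho0; rewrite sqrtr_eq0 subr_le0 => rz.
  have : z ^+ 2 = r ^+ 2.
    apply/le_anti; rewrite rz andbT -(real_normK (num_real z)).
    by rewrite ler_pXn2r ?nnegrE ?(ltW r0).
  move/eqP; rewrite eqf_sqr => /orP[]/eqP ->.
    by rewrite scale_radius mul0r.
  by rewrite opprK scale_radius mulr0.
have {ct st} [ct st] : cos t' = cos t /\ sin t' = sin t.
  by split; apply: (mulfI rho_neq0).
rewrite w_polyline//; congr (folded (_, _) z).
all: have [->//|[-> ->]] := cos_sin_inj ht' ht ct st.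
all: by rewrite ?wx_periodic ?wy_periodic.
Qed.

(** * The image lies on the polyhedron *)

Lemma mapT_polyhedronK : set_fun (sphere3 r) (polyhedronK n r eps) (mapT n r eps).
Proof.
have er0 : 0 <= eps * r by rewrite mulr_ge0// ltW.
move=> [[x y] z] /sphere3_longitude[ht _]; rewrite mapTE.
set t := longitude r _ in ht *; have [it _] := sectorP n3 ht.
(* [A] is left free so that the same fact serves the pyramid faces and the prism faces. *)
have vertices_hull h A :
    [set vertex n r h (sector n t); vertex n r h (sector n t).+1] `<=` A ->
    convex_hull A (r * (w n t).1, r * (w n t).2, h).
  move=> VA; have [c c01 ->] := w_between_vertices n3 r h ht.
  by apply: convex_hull_comb => //; apply: sub_convex_hull; apply: VA; [left|right].
rewrite /folded [(_, z).2]/=.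
case: (boolP (eps * r < z)) => [zgt|]; last rewrite -leNgt => zle.
  left; right; exists (sector n t) => //.
  rewrite (scale_eq1 (z := - z)); last lra.
  rewrite min_r ?max_l ?(ltW zgt)//; last lra.
  pose apex : R * R * R := (0, 0, eps * r + altitude n r eps).
  (* The homothety factor [scale z] is the weight of the base point, its complement that of the
     apex. *)
  have := convex_hull_comb (scale_ge0_le1 z)
    (vertices_hull (eps * r) _ (@subsetUl _ _ [set apex]))
    (sub_convex_hull (@subsetUr _ _ [set apex] _ erefl)).
  congr (convex_hull _ _); congr (_, _, _); rewrite /=; ring.
rewrite (scale_eq1 zle) min_l//.
case: (boolP (z < - (eps * r))) => [zlt|]; last rewrite -leNgt => zge.
  right; exists (sector n t) => //.
  rewrite max_r ?(ltW zlt)//.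
  pose apex : R * R * R := (0, 0, - (eps * r) - altitude n r eps).
  have := convex_hull_comb (scale_ge0_le1 (- z))
    (vertices_hull (- (eps * r)) _ (@subsetUl _ _ [set apex]))
    (sub_convex_hull (@subsetUr _ _ [set apex] _ erefl)).
  by congr (convex_hull _ _); congr (_, _, _); rewrite /=; ring.
left; left; exists (sector n t) => //.
rewrite scale_eq1 ?max_l//; last lra.
set A := (X in convex_hull X).
have lo : convex_hull A (r * (w n t).1, r * (w n t).2, - (eps * r)).
  by apply: vertices_hull => p pV; left; left.
have hi : convex_hull A (r * (w n t).1, r * (w n t).2, eps * r).
  by apply: vertices_hull => p [->|->]; [left; right|right].
(* For [eps = 0] the prism is a polygon and the weight [c] below would have denominator 0; the point
   is then already [hi]. *)
have [er_eq0|er_neq0] := eqVneq (eps * r) 0.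
  have z0 : z = 0 by lra.
  move: hi; rewrite er_eq0 z0; congr (convex_hull _ _); congr (_, _, _); ring.
have er_gt0 : 0 < 2 * (eps * r) by rewrite mulr_gt0// lt_neqAle eq_sym er_neq0.
(* The weight of the lower endpoint: affine in [z], 1 on the lower base and 0 on the upper one. *)
pose c := (eps * r - z) / (2 * (eps * r)).
have c01 : 0 <= c <= 1.
  by rewrite divr_ge0 ?(ltW er_gt0) ?subr_ge0//= ler_pdivrMr//; lra.
have cz : c * - (eps * r) + (1 - c) * (eps * r) = z.
  rewrite /c; field.
  by move: er_neq0; rewrite mulf_eq0 negb_or => /andP[-> ->].
have := convex_hull_comb c01 lo hi; rewrite /= cz.
congr (convex_hull _ _); congr (_, _, _); ring.
Qed.

End Parametrisation.

Theorem proposition4 (R : realType) (n : nat) (r eps : R)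
  (hn : (3 <= n)%N) (hr : 0 < r) (heps0 : 0 <= eps) (heps1 : eps < 1) :
  set_fun (sphere3 r) (polyhedronK n r eps) (mapT n r eps) /\
  {within sphere3 r, continuous (mapT n r eps)}.
Proof.
split; first exact: mapT_polyhedronK.
rewrite -(sphere_param_image hr).
apply: (within_continuous_compact_image (g := mapT_param n r eps)).
- exact: norm_hausdorff.
- exact: compact_param_domain.
- exact: continuous_sphere_param.
- exact: continuous_mapT_param.
- exact: mapT_sphere_param.
Qed.
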